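(* Let $(X,\mathcal{A})$ be a $T$-measurable space. For every element $P$ of $\mathcal{A}$, $P$ is a prime element of $\mathcal{A}$ if and only if $|X\setminus P|=1$.
   Context: A measurable space $(X,\mathcal{A})$ is a nonempty set $X$ with a $\sigma$-algebra $\mathcal{A}$ of subsets of $X$. It is $T$-measurable if whenever $x,y$ are distinct points of $X$, there is a set in $\mathcal{A}$ containing one of them and not the other. $\mathcal{A}$ is regarded as a lattice under inclusion; a prime element of $\mathcal{A}$ is a $P\in\mathcal{A}$ with $P\subsetneq X$ such that for all $A,B\in\mathcal{A}$, $A\cap B\subseteq P$ implies $A\subseteq P$ or $B\subseteq P$. *)

(* Defs.v *)
From mathcomp Require Import all_boot.
From mathcomp Require Import boolp classical_sets.
From mathcomp Require Import functions cardinality measurable_structure.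

Set Implicit Arguments.
Unset Strict Implicit.
Unset Printing Implicit Defensive.

Local Open Scope classical_set_scope.

(* A [measurableType] is pointed, so that the space is nonempty; [measurable] is
   its sigma-algebra. *)
Definition T_measurable (d : measure_display) (X : measurableType d) : Prop :=
  forall x y : X, x <> y ->
    exists A : set X, d.-measurable A /\ ((A x /\ ~ A y) \/ (A y /\ ~ A x)).

Definition prime_measurable (d : measure_display) (X : measurableType d)
    (P : set X) : Prop :=
  [/\ d.-measurable P, P `<` [set: X] &
      forall A B : set X, d.-measurable A -> d.-measurable B ->
        A `&` B `<=` P -> A `<=` P \/ B `<=` P].

(* Main.v *)
Require Import Defs.
From mathcomp Require Import all_boot.
From mathcomp Require Import boolp classical_sets.
From mathcomp Require Import functions cardinality measurable_structure.

(** Because [A] and [~` A] are disjoint, their intersection lies inside [P], so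
    primality forces one of the two into [P]: no measurable set splits the
    complement of [P] ([prime_measurable_unsplit]).  As measurable sets separate
    points, that complement, which is nonempty because [P] is proper, has only
    one point.

    Conversely, when the complement of [P] is a singleton of element [x], the
    inclusion [A `<=` P] just means that [x] is not in [A], so that primality
    reduces to the fact that a point of both [A] and [B] belongs to their
    intersection ([prime_measurable_setC1]). *)

Local Open Scope classical_set_scope.

Lemma card_eq_I1P {T : Type} {A : set T} :
  (A #= `I_1)%card <-> exists x, A = [set x].
Proof.
split=> [|[x ->]]; last exact: card_set1.
rewrite II1 => /card_set_bijP[f [f_fun f_inj f_surj]].
have [x Ax fx] := f_surj 0%N erefl.
exists x; apply/seteqP; split=> [y Ay|_ -> //].
by apply: f_inj; rewrite ?inE// fx; apply: f_fun.
Qed.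

(** If [A] contained [x] but not [y], then neither [A] nor [~` A] would be
    inside [P], although their intersection, being empty, is. *)
Lemma prime_measurable_unsplit {d : measure_display} {X : measurableType d}
    {P A : set X} {x y : X} :
  prime_measurable P -> d.-measurable A -> ~ P x -> ~ P y -> A x -> A y.
Proof.
move=> [_ _ primeP] mA nPx nPy Ax; apply: contrapT => nAy.
have [|AP|CAP] := primeP A (~` A) mA (measurableC mA).
- by rewrite setICr; apply: sub0set.
- exact/nPx/AP.
- exact/nPy/CAP.
Qed.

Lemma prime_measurable_setC1 {d : measure_display} {X : measurableType d}
    {P : set X} {x : X} :
  d.-measurable P -> ~` P = [set x] -> prime_measurable P.
Proof.
move=> mP CP.
have nPx : ~ P x by have : (~` P) x by rewrite CP.
have subPE (A : set X) : ~ A x -> A `<=` P.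
  move=> nAx z Az; apply: contrapT => nPz; apply: nAx.
  by have <- : z = x by have : (~` P) z by []; rewrite CP.
split=> //; first by split=> [//|/(_ x I)].
move=> A B _ _ ABP; have [Ax|nAx] := pselect (A x); last by left; apply: subPE.
by right; apply: subPE => Bx; apply/nPx/ABP.
Qed.

Theorem corollary2 (d : measure_display) (X : measurableType d)
    (X_T : T_measurable X) (P : set X) (mP : d.-measurable P) :
  prime_measurable P <-> (([set: X] `\` P) #= `I_1)%card.
Proof.
rewrite setTD; split=> [primeP|/card_eq_I1P[x CP]]; last first.
  exact: prime_measurable_setC1 mP CP.
apply/card_eq_I1P; have [_ [_ nTP] _] := primeP.
have /existsNP[x nPx] : ~ forall z, P z by move=> allP; apply: nTP => z _.
exists x; apply/seteqP; split=> [y nPy|_ ->//].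
apply: contrapT => /X_T[A [mA [[Ay nAx]|[Ax nAy]]]].
- exact/nAx/(prime_measurable_unsplit primeP mA nPy nPx Ay).
- exact/nAy/(prime_measurable_unsplit primeP mA nPx nPy Ax).
Qed.
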